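(* Let $\mathrm{Dih}(m,G,\alpha)$ and $\mathrm{Dih}(\overline{m},\overline{G},\overline{\alpha})$ be two finite dihedral-like automorphic loops. Then they are isomorphic as loops if and only if $m=\overline{m}$ and there is a group isomorphism $\gamma:G\to\overline{G}$ such that $\gamma^{-1}\alpha\gamma=\overline{\alpha}$ (that is, $m=\overline m$, $G=\overline G$ up to isomorphism, and, after identifying $\overline G$ with $G$, $\alpha$ is conjugate to $\overline{\alpha}$ in $\mathrm{Aut}(G)$).
   Context: Let $m\ge 2$ be an even integer, $G$ an abelian group (written additively) and $\alpha\in\mathrm{Aut}(G)$, where $\alpha^2=1$ is required if $m>2$ (no condition on $\alpha$ if $m=2$). The dihedral-like automorphic loop $\mathrm{Dih}(m,G,\alpha)$ is the loop defined on $\mathbb{Z}_m\times G$ by $(i,u)(j,v)=(i+j,(s_ju+v)\alpha^{ij})$, where $s_j=(-1)^j$, $i,j\in\{0,\dots,m-1\}$, the first coordinate is added modulo $m$, and the exponent $ij$ is the integer product, not reduced modulo $m$. Its identity element is $(0,0)$. It is finite when $G$ is finite. Maps are written to the right of their arguments and are composed from left to right. *)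

(* Defs.v *)
From mathcomp Require Import all_boot all_order all_algebra all_fingroup.

Set Implicit Arguments.
Unset Strict Implicit.
Unset Printing Implicit Defensive.

Import GRing.Theory.
Local Open Scope ring_scope.

Record loop := Loop {
  loop_sort :> Type;
  loop_mul : loop_sort -> loop_sort -> loop_sort;
  loop_one : loop_sort;
  loop_mul1l : left_id loop_one loop_mul;
  loop_mul1r : right_id loop_one loop_mul;
  loop_divl : forall a b, exists! x, loop_mul a x = b;
  loop_divr : forall a b, exists! y, loop_mul y a = b
}.

Definition loop_isomorphic (P Q : loop) : Prop :=
  exists2 f : P -> Q, bijective f &
    forall x y, f (loop_mul x y) = loop_mul (f x) (f y).

(* 'Z_m is Z/mZ only for 1 < m.  Its elements coerce to their
   representatives in {0, ..., m - 1}, so both exponents below are computed in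
   nat.  The product of {perm G} is left-to-right composition. *)
Definition dih_mul (m : nat) (G : finZmodType) (alpha : {perm G})
    (x y : 'Z_m * G) : 'Z_m * G :=
  let: (i, u) := x in
  let: (j, v) := y in
  (i + j, (alpha ^+ (i * j)%N)%g (u *~ (-1) ^+ (j : nat) + v)).

Lemma Aut_zmodP (G : finZmodType) (alpha : {perm G}) :
  alpha \in Aut [set: G] <-> {morph alpha : u v / u + v}.
Proof.
split=> [/setIdP[_ /morphicP alphaD] u v|alphaD].
  by apply: alphaD; rewrite inE.
apply/setIdP; split; first by apply/subsetP=> u; rewrite !inE.
by apply/morphicP=> u v _ _; apply: alphaD.
Qed.

Lemma dih_mul1l (m : nat) (G : finZmodType) (alpha : {perm G}) :
  left_id (0, 0) (@dih_mul m G alpha).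
Proof.
by move=> [j v]; rewrite /dih_mul /= add0r mul0n expg0 perm1 mul0rz add0r.
Qed.

Lemma dih_mul1r (m : nat) (G : finZmodType) (alpha : {perm G}) :
  right_id (0, 0) (@dih_mul m G alpha).
Proof.
move=> [i u].
by rewrite /dih_mul /= addr0 muln0 expg0 perm1 expr0 mulr1z addr0.
Qed.

Lemma signzK (G : finZmodType) (n : nat) : involutive (fun u : G => u *~ (-1) ^+ n).
Proof. by move=> u; rewrite -mulrzA -expr2 sqrr_sign mulr1z. Qed.

Lemma dih_divl (m : nat) (G : finZmodType) (alpha : {perm G})
    (a b : 'Z_m * G) :
  exists! x, dih_mul alpha a x = b.
Proof.
case: a b => [i u] [k w]; pose j := k - i.
exists (j, ((alpha ^+ (i * j)%N)%g^-1)%g w - u *~ (-1) ^+ (j : nat)).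
rewrite /dih_mul /j; split=> [|[j' v] [<- <-]].
  by rewrite addrC subrK [in LHS](addrC (u *~ _)) subrK permKV.
by rewrite addrAC subrr add0r permK [_ + v]addrC addrK.
Qed.

Lemma dih_divr (m : nat) (G : finZmodType) (alpha : {perm G})
    (a b : 'Z_m * G) :
  exists! y, dih_mul alpha y a = b.
Proof.
case: a b => [j v] [k w]; pose i := k - j.
exists (i, (((alpha ^+ (i * j)%N)%g^-1)%g w - v) *~ (-1) ^+ (j : nat)).
rewrite /dih_mul /i; split=> [|[i' u] [<- <-]].
  by rewrite subrK signzK subrK permKV.
by rewrite addrK permK addrK signzK.
Qed.

Definition Dih (m : nat) (G : finZmodType) (alpha : {perm G}) : loop :=
  Loop (@dih_mul1l m G alpha) (@dih_mul1r m G alpha) (@dih_divl m G alpha) (@dih_divr m G alpha).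

(* Main.v *)
(* Let E be the elements of Dih(m, G, alpha) with even first coordinate.  If
   alpha <> 1 then E is the middle nucleus; if 2 G <> 0 then E is the centralizer
   of any noncentral x such that x^2 is a nontrivial commutator.  Otherwise the
   loop is the abelian group Z_m * G with G an elementary abelian 2-group, and
   it has exponent m.
   In the first two cases an isomorphism f preserves E, hence also the subgroup
   K of elements (i, 0) with i even, which is generated by the squares of the
   elements outside E.  So f induces an isomorphism gamma between the quotients
   E / K, i.e. between the groups G, and applying f to
   (2, 0)(0, u alpha) = (1, 0)((1, 0)(0, u)) shows that gamma intertwines alpha
   and alpha'. *)
Require Import Defs.
From HB Require Import structures.
From mathcomp Require Import all_boot all_order all_algebra all_fingroup.
From mathcomp Require Import abelian.

Set Implicit Arguments.
Unset Strict Implicit.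
Unset Printing Implicit Defensive.

(** * Parity of the first coordinate and the multiplication formula *)

Section DihTheory.

Import GRing.Theory.
Local Open Scope ring_scope.

(* Blocks [/=], which would otherwise unfold the addition of 'Z_m under [odd]. *)
Definition parity (m : nat) (i : 'Z_m) : bool := odd i.
Arguments parity {m} i : simpl never.

(** Bijectivity is carried by [{perm G}], so additivity makes [alpha] an automorphism. *)
Definition dih_datum (m : nat) (G : finZmodType) (alpha : {perm G}) :=
  [/\ (1 < m)%N, ~~ odd m, {morph alpha : u v / u + v}
    & (2 < m)%N -> (alpha ^+ 2)%g = 1%g].

Lemma dih_datum0 (m : nat) (G : finZmodType) (alpha : {perm G}) :
  dih_datum m alpha -> alpha 0 = 0.
Proof.
by case=> _ _ alphaD _; apply: (addrI (alpha 0)); rewrite -alphaD !addr0.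
Qed.

Lemma parity1 (m : nat) : parity (1 : 'Z_m).
Proof. by []. Qed.

Lemma parity0 (m : nat) : parity (0 : 'Z_m) = false.
Proof. by []. Qed.

Lemma parityD (m : nat) (i j : 'Z_m) :
  (1 < m)%N -> ~~ odd m -> parity (i + j) = parity i (+) parity j.
Proof.
move=> m_gt1 m_even; rewrite /parity /= odd_mod ?oddD //.
by rewrite Zp_cast //; apply/negbTE.
Qed.

Lemma mulrz_signE (G : zmodType) (u : G) (n : nat) :
  u *~ (-1) ^+ n = if odd n then - u else u.
Proof. by rewrite -signr_odd; case: odd; rewrite ?expr1 ?mulrN1z ?mulr1z. Qed.

(* For m = 2 there is no condition on alpha, but then i * j <= 1. *)
Lemma dih_mulE (m : nat) (G : finZmodType) (alpha : {perm G})
    (x y : 'Z_m * G) :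
  dih_datum m alpha ->
  dih_mul alpha x y =
  (x.1 + y.1, (alpha ^+ (parity x.1 && parity y.1))%g
                ((if parity y.1 then - x.2 else x.2) + y.2)).
Proof.
case: x y => [i u] [j v] [m_gt1 _ _ alpha2].
rewrite /dih_mul mulrz_signE /parity -oddM.
suff -> : (alpha ^+ (i * j)%N)%g = (alpha ^+ odd (i * j))%g by [].
case: (ltnP 2 m) => [/alpha2 a2 | m_le2].
  rewrite -{1}[(i * j)%N]odd_double_half -mul2n expgD expgM a2.
  by rewrite expg1n mulg1.
have lt2 (k : 'Z_m) : (k < 2)%N.
  by apply: (leq_trans (ltn_ord k)); rewrite Zp_cast.
by move: (lt2 i) (lt2 j); case: (nat_of_ord i) => [|[|]] //;
  case: (nat_of_ord j) => [|[|]].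
Qed.

(** * Commutation, the middle nucleus and commutators *)

(** An even [x] brings in no [alpha]; the two products differ only in the sign of [x.2], and only
    against an odd [y]. *)
Lemma dih_commE (m : nat) (G : finZmodType) (alpha : {perm G})
    (x y : 'Z_m * G) :
  dih_datum m alpha -> ~~ parity x.1 ->
  (dih_mul alpha x y == dih_mul alpha y x) =
  ~~ parity y.1 || (x.2 + x.2 == 0).
Proof.
case: x y => [k w] [j v] dm /negbTE k0; rewrite !dih_mulE // k0 andbF /=.
rewrite [k + j]addrC expg0 !perm1 xpair_eqE eqxx /=; case: (parity j) => /=.
  by rewrite addrC (inj_eq (addrI v)) eq_sym -addr_eq0.
by rewrite addrC eqxx.
Qed.

Lemma dih_nucleus_mid (m : nat) (G : finZmodType) (alpha : {perm G})
    (y : 'Z_m * G) :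
  dih_datum m alpha ->
  (forall x z, dih_mul alpha (dih_mul alpha x y) z =
               dih_mul alpha x (dih_mul alpha y z)) <->
  ~~ parity y.1 \/ alpha = 1%g.
Proof.
case: y => j v dm; have [m_gt1 m_even alphaD _] := dm.
split=> [nuc|].
  case: (boolP (parity j)) => [j1 | ]; [right | by left].
  apply/permP=> u; rewrite perm1.
  (* For odd [j] the second coordinates of the two sides are [alpha (u - v)] and
     [u + alpha (- v)]. *)
  move: (nuc (0, u) (1, 0)); rewrite !dih_mulE //= !parityD // j1 /=.
  rewrite !expg0 !expg1 !perm1 !addr0 => -[_].
  by rewrite opprD opprK alphaD; move/addIr.
move=> e [i u] [k w]; rewrite !dih_mulE //= !parityD //= addrA.
congr (_, _).
case: e => [/= /negbTE -> | ->].
  rewrite ?andbF ?andFb ?addbF ?addFb /= !expg0 !perm1.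
  by case: (parity k); rewrite ?opprD addrA.
rewrite !expg1n !perm1.
by case: (parity j); case: (parity k); rewrite ?opprD ?opprK addrA.
Qed.

(** Here [r] is the commutator of [p] and [q], and the first coordinate maps into an abelian
    group. *)
Lemma dih_commutator (m : nat) (G : finZmodType) (alpha : {perm G})
    (p q r : 'Z_m * G) :
  dih_mul alpha p q = dih_mul alpha (dih_mul alpha q p) r -> r.1 = 0.
Proof.
case: p q r => [i u] [j v] [k w] /(congr1 fst) /=; rewrite [j + _]addrC => e.
by apply: (addrI (i + j)); rewrite addr0.
Qed.

(** * Isomorphisms preserve the even part *)

Section Isomorphism.

Variables (m m' : nat) (G G' : finZmodType).
Variables (alpha : {perm G}) (alpha' : {perm G'}).
Hypotheses (dm : dih_datum m alpha) (dm' : dih_datum m' alpha').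
Variables (f : 'Z_m * G -> 'Z_m' * G') (g : 'Z_m' * G' -> 'Z_m * G).
Hypotheses (fK : cancel f g) (gK : cancel g f).
Hypothesis fM : {morph f : x y / dih_mul alpha x y >-> dih_mul alpha' x y}.

Lemma dih_iso0 : f 0 = 0.
Proof.
have /esym := fM 0 0; rewrite dih_mul1l.
have [y [_ uniq_y]] := dih_divl alpha' (f 0) (f 0).
by move=> /uniq_y <-; apply: uniq_y; apply: dih_mul1r.
Qed.

(* The square of (0, u0) is a nontrivial commutator, whereas the square of an
   element outside the even part has trivial second coordinate; and the even
   part is the centralizer of (0, u0). *)
Lemma parity_iso_double (u0 : G) : u0 + u0 != 0 ->
  forall x, parity (f x).1 = parity x.1.
Proof.
move=> u0_neq; have alpha'0 := dih_datum0 dm'.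
pose x0 : 'Z_m * G := (0, u0).
have sqr_comm : (dih_mul alpha' (f x0) (f x0)).1 = 0.
  (* Apply [f] to [(1, 0) (0, u0) = ((0, u0) (1, 0)) (0, u0 + u0)]. *)
  rewrite -fM; apply: (@dih_commutator _ _ alpha' (f (1, 0)) (f (0, u0))).
  rewrite -!fM; congr f; rewrite !dih_mulE //=.
  by rewrite !addr0 !add0r !expg0 !perm1 addKr.
have fx0_even : ~~ parity (f x0).1.
  apply/negP=> odd_fx0; case/eqP: u0_neq.
  have : f (dih_mul alpha x0 x0) = f 0.
    rewrite dih_iso0 fM [LHS]surjective_pairing sqr_comm.
    by rewrite dih_mulE // odd_fx0 /= addNr expg1 alpha'0.
  move/(can_inj fK); rewrite dih_mulE // parity0 /= expg0 perm1.
  by move/(congr1 snd).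
have commE y : ~~ parity y.1 = ~~ parity (f y).1 || ((f x0).2 + (f x0).2 == 0).
  rewrite -(dih_commE (f y) dm' fx0_even) -!fM (inj_eq (can_inj fK)).
  by rewrite dih_commE // (negbTE u0_neq) orbF.
(* At the odd [(1, 0)], [commE] forces the second coordinate of [f x0] to have a nonzero double. *)
have := commE (1, 0); rewrite parity1 /= => /esym/norP[_ /negbTE fx0_neq] x.
by apply: negb_inj; rewrite commE fx0_neq orbF.
Qed.

Lemma parity_iso_nontrivial : alpha <> 1%g ->
  forall x, parity (f x).1 = parity x.1.
Proof.
move=> alpha_neq.
have nucE y : ~~ parity y.1 \/ alpha = 1%g <-> ~~ parity (f y).1 \/ alpha' = 1%g.
  split=> /dih_nucleus_mid nuc; apply/dih_nucleus_mid=> // x z.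
    by rewrite -[x]gK -[z]gK -!fM nuc.
  by apply: (can_inj fK); rewrite !fM nuc.
have alpha'_neq : alpha' <> 1%g.
  (* If [alpha'] were trivial, the middle nucleus would be the whole target, hence the whole source,
     against the odd [(1, 0)]. *)
  by move=> a'1; have [_ /(_ (or_intror a'1))[]] := nucE (1, 0).
move=> x; apply: negb_inj; apply/idP/idP => even_x.
  by have [_ /(_ (or_introl even_x))[]] := nucE x.
by have [/(_ (or_introl even_x))[] ] := nucE x.
Qed.

(** * The induced map between the groups *)

Section EvenPreserved.

Hypothesis f_parity : forall x, parity (f x).1 = parity x.1.

(** The map induced on the quotients by [K]: the first coordinate of [f (0, u)], possibly nonzero,
    is dropped. *)
Definition iso_fiber (u : G) : G' := (f (0, u)).2.

(* Squares of odd elements generate the even multiples of (1, 0). *)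
Lemma iso_base_even (i : 'Z_m) : ~~ parity i -> (f (i, 0)).2 = 0.
Proof.
have [m_gt1 m_even _ _] := dm; have [m'_gt1 m'_even _ _] := dm'.
have alpha'0 := dih_datum0 dm'.
have base_double n : (f (n.*2%:R, 0)).2 = 0 /\ ~~ parity (n.*2%:R : 'Z_m).
  elim: n => [|n [IH1 IH2]]; first by split=> //; apply: (congr1 snd dih_iso0).
  have step : (n.+1.*2%:R, 0) =
    dih_mul alpha (dih_mul alpha (1, 0) (1, 0)) (n.*2%:R, 0) :> 'Z_m * G.
    rewrite !dih_mulE //= !parityD // parity1 (negbTE IH2) /= oppr0 !addr0.
    rewrite expg0 perm1 expg1 (dih_datum0 dm) doubleS -[n.*2.+2]add2n natrD.
    by [].
  split; last first.
    have -> : (n.+1.*2%:R : 'Z_m) = 1 + 1 + n.*2%:R.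
      by rewrite doubleS -[n.*2.+2]add2n natrD.
    by rewrite !parityD // (negbTE IH2).
  (* Since [f (1, 0)] is odd, its second coordinate cancels in its square. *)
  rewrite step !fM.
  rewrite !dih_mulE //= !parityD // !f_parity /= (negbTE IH2) /= IH1.
  by rewrite expg0 perm1 addNr expg1 alpha'0 addr0.
move=> i_even; have [] := base_double i./2.
by rewrite even_halfK // natr_Zp.
Qed.

Lemma iso_fiberD : {morph iso_fiber : u v / u + v}.
Proof.
move=> u v; rewrite /iso_fiber.
have -> : (0, u + v) = dih_mul alpha (0, u) (0, v) :> 'Z_m * G.
  by rewrite dih_mulE //= expg0 perm1 addr0.
by rewrite fM dih_mulE // !f_parity /= expg0 perm1.
Qed.

Lemma iso_fiber_alpha (u : G) : iso_fiber (alpha u) = alpha' (iso_fiber u).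
Proof.
have [m_gt1 m_even _ _] := dm; have [m'_gt1 m'_even _ _] := dm'.
have factor : dih_mul alpha (1 + 1, 0) (0, alpha u) =
              dih_mul alpha (1, 0) (dih_mul alpha (1, 0) (0, u)) :> 'Z_m * G.
  rewrite !dih_mulE //= andbF expg0 !perm1 expg1.
  by rewrite oppr0 !add0r !addr0.
(* The unknown second coordinate of the odd [f (1, 0)] enters the right side twice, with opposite
   signs. *)
have := congr1 f factor; rewrite !fM => /(congr1 snd).
rewrite !dih_mulE //= !parityD // !f_parity /=.
rewrite iso_base_even ?parityD // add0r andbF !expg0 !perm1 expg1.
by rewrite addKr.
Qed.

End EvenPreserved.

End Isomorphism.

(** * Conjugacy from a parity-preserving isomorphism *)

Lemma morph_can2 (T T' : Type) (op : T -> T -> T) (op' : T' -> T' -> T')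
    (f : T -> T') (g : T' -> T) :
  cancel f g -> cancel g f ->
  {morph f : x y / op x y >-> op' x y} -> {morph g : x y / op' x y >-> op x y}.
Proof. by move=> fK gK fM x y; apply: (can_inj fK); rewrite fM !gK. Qed.

(** For [w] in the kernel, [f (0, w)] is some [(i, 0)] with [i] even, which [g] sends back to an
    element with second coordinate 0. *)
Lemma iso_fiber_inj (m m' : nat) (G G' : finZmodType)
    (alpha : {perm G}) (alpha' : {perm G'})
    (f : 'Z_m * G -> 'Z_m' * G') (g : 'Z_m' * G' -> 'Z_m * G) :
  dih_datum m alpha -> dih_datum m' alpha' ->
  cancel f g -> cancel g f ->
  {morph f : x y / dih_mul alpha x y >-> dih_mul alpha' x y} ->
  (forall x, parity (f x).1 = parity x.1) -> injective (iso_fiber f).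
Proof.
move=> dm dm' fK gK fM f_parity u v; rewrite -[u](subrK v).
set w := u - v; rewrite (iso_fiberD dm dm' fM f_parity) => e.
have w_ker : iso_fiber f w = 0 by apply: (addIr (iso_fiber f v)); rewrite e add0r.
suff -> : w = 0 by rewrite add0r.
have fw : f (0, w) = ((f (0, w)).1, 0) by rewrite -w_ker -surjective_pairing.
have g_parity x : parity (g x).1 = parity x.1 by rewrite -f_parity gK.
have gM := morph_can2 fK gK fM.
have := iso_base_even dm' dm gM g_parity (i := (f (0, w)).1).
by rewrite f_parity -fw fK; apply.
Qed.

Lemma additive_morph (U V : zmodType) (h : U -> V) :
  {morph h : u v / u + v} -> exists gamma : {additive U -> V}, gamma =1 h.
Proof.
move=> hD.
have hB : zmod_morphism h.
  by move=> u v; apply/eqP; rewrite -subr_eq opprK -hD subrK.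
pose hA := GRing.isZmodMorphism.Build U V h hB.
by exists (HB.pack_for {additive U -> V} h hA).
Qed.

Lemma dih_card_fiber (m m' : nat) (G G' : finZmodType) :
  (1 < m)%N -> (1 < m')%N -> #|{: 'Z_m * G}| = #|{: 'Z_m' * G'}| ->
  #|G| = #|G'| -> m = m'.
Proof.
move=> m_gt1 m'_gt1; rewrite !card_prod !card_ord !Zp_cast // => + cardG.
rewrite cardG => /eqP; rewrite eqn_pmul2r => [/eqP|] //.
by apply/card_gt0P; exists 0.
Qed.

(** The maps induced by [f] and by [g] are injective, so [G] and [G'] have equal order; counting the
    loops then gives [m = m']. *)
Lemma dih_conj_of_parity (m m' : nat) (G G' : finZmodType)
    (alpha : {perm G}) (alpha' : {perm G'})
    (f : 'Z_m * G -> 'Z_m' * G') (g : 'Z_m' * G' -> 'Z_m * G) :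
  dih_datum m alpha -> dih_datum m' alpha' ->
  cancel f g -> cancel g f ->
  {morph f : x y / dih_mul alpha x y >-> dih_mul alpha' x y} ->
  (forall x, parity (f x).1 = parity x.1) ->
  m = m' /\
  exists (gamma : {additive G -> G'}) (gammaV : G' -> G),
    [/\ cancel gamma gammaV, cancel gammaV gamma &
        gamma \o alpha \o gammaV =1 alpha'].
Proof.
move=> dm dm' fK gK fM f_parity.
have g_parity x : parity (g x).1 = parity x.1 by rewrite -f_parity gK.
have f_inj := iso_fiber_inj dm dm' fK gK fM f_parity.
have g_inj := iso_fiber_inj dm' dm gK fK (morph_can2 fK gK fM) g_parity.
have cardG : #|G| = #|G'|.
  by apply/eqP; rewrite eqn_leq (leq_card _ f_inj) (leq_card _ g_inj).
split.
  have [[m_gt1 _ _ _] [m'_gt1 _ _ _]] := (dm, dm').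
  by apply: dih_card_fiber cardG => //; apply: bij_eq_card (Bijective fK gK).
have [gamma gammaE] := additive_morph (iso_fiberD dm dm' fM f_parity).
have gamma_inj : injective gamma by apply: eq_inj f_inj _ => u; rewrite gammaE.
have [|gammaV gammaK gammaVK] := inj_card_bij gamma_inj; first by rewrite cardG.
exists gamma, gammaV; split=> // u /=.
by rewrite gammaE (iso_fiber_alpha dm dm' fM f_parity) -gammaE gammaVK.
Qed.

(** * The exceptional case of elementary abelian 2-groups *)

Lemma dih_mul_trivial (m : nat) (G : finZmodType) :
  dih_datum m (1%g : {perm G}) -> (forall u : G, u + u = 0) ->
  forall x y : 'Z_m * G, dih_mul 1%g x y = x + y.
Proof.
move=> dm dbl0 x y; rewrite dih_mulE // expg1n perm1.
suff -> : (if parity y.1 then - x.2 else x.2) = x.2 by [].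
by case: parity => //; apply/eqP; rewrite eq_sym -addr_eq0 dbl0.
Qed.

(** The element [(1, 0)] has order [m], while the even number [m'] annihilates the target. *)
Lemma dih_trivial_dvd (m m' : nat) (G G' : finZmodType)
    (f : 'Z_m * G -> 'Z_m' * G') :
  (1 < m)%N -> (1 < m')%N -> ~~ odd m' -> (forall u : G', u + u = 0) ->
  injective f -> {morph f : x y / x + y} -> (m %| m')%N.
Proof.
move=> m_gt1 m'_gt1 m'_even dbl0 f_inj fD.
have [h hE] := additive_morph fD.
have : (1, 0) *+ m' = 0 :> 'Z_m * G.
  apply: f_inj; rewrite -!hE raddfMn raddf0; case: (h _) => i u.
  rewrite pairMnE; congr (_, _); last first.
    by rewrite /= -[m']even_halfK // -mul2n mulrnA mulr2n dbl0 mul0rn.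
  have m'0 : m'%:R = 0 :> 'Z_m' by apply: val_inj; rewrite /= val_Zp_nat // modnn.
  by rewrite -mulr_natr m'0 mulr0.
move/(congr1 (fun x : 'Z_m * G => nat_of_ord x.1)).
by rewrite pairMnE [LHS]val_Zp_nat // => /eqP.
Qed.

(** Elementary abelian 2-groups are classified by their order. *)
Lemma elementary_iso (G G' : finZmodType) :
  (forall u : G, u + u = 0) -> (forall u : G', u + u = 0) -> #|G| = #|G'| ->
  exists (gamma : {additive G -> G'}) (gammaV : G' -> G),
    cancel gamma gammaV /\ cancel gammaV gamma.
Proof.
have abel (H : finZmodType) : (forall u : H, u + u = 0) ->
    2.-abelem%g [set: H].
  move=> dbl0; apply/abelemP=> //; split; first exact: FinRing.zmod_abelian.
  by move=> u _; rewrite FinRing.zmodXgE mulr2n dbl0.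
move=> dbl0 dbl0' cardG.
have : [set: G] \isog [set: G'].
  by rewrite (isog_abelem_card _ (abel _ dbl0)) abel // !cardsT cardG eqxx.
case/isogP=> h /injmP h_inj _.
have hD : {morph h : u v / u + v} by move=> u v; apply: morphM; rewrite inE.
have [gamma gammaE] := additive_morph hD.
have gamma_inj : injective gamma.
  by move=> u v; rewrite !gammaE; apply: h_inj; rewrite inE.
have [|gammaV gammaK gammaVK] := inj_card_bij gamma_inj; first by rewrite cardG.
by exists gamma, gammaV.
Qed.

(** * Isomorphic loops have conjugate data *)

Lemma dih_iso_conj (m m' : nat) (G G' : finZmodType)
    (alpha : {perm G}) (alpha' : {perm G'})
    (f : 'Z_m * G -> 'Z_m' * G') (g : 'Z_m' * G' -> 'Z_m * G) :
  dih_datum m alpha -> dih_datum m' alpha' ->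
  cancel f g -> cancel g f ->
  {morph f : x y / dih_mul alpha x y >-> dih_mul alpha' x y} ->
  m = m' /\
  exists (gamma : {additive G -> G'}) (gammaV : G' -> G),
    [/\ cancel gamma gammaV, cancel gammaV gamma &
        gamma \o alpha \o gammaV =1 alpha'].
Proof.
move=> dm dm' fK gK fM; have gM := morph_can2 fK gK fM.
have conj_f := dih_conj_of_parity dm dm' fK gK fM.
(* A nontrivial permutation or a nonzero double may exist only on the target side; the argument then
   runs on [g]. *)
have parity_inv : (forall x, parity (g x).1 = parity x.1) ->
    forall x, parity (f x).1 = parity x.1.
  by move=> g_parity x; rewrite -g_parity fK.
have [alpha1 | /eqP alpha_neq] := eqVneq alpha 1%g; last first.
  exact/conj_f/(parity_iso_nontrivial dm dm' fK gK fM).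
have [alpha'1 | /eqP alpha'_neq] := eqVneq alpha' 1%g; last first.
  exact/conj_f/parity_inv/(parity_iso_nontrivial dm' dm gK fK gM).
have [/existsP[u0 u0_neq] | /existsPn dbl0] := boolP [exists u : G, u + u != 0].
  exact/conj_f/(parity_iso_double dm dm' fK fM u0_neq).
have [/existsP[u0 u0_neq] | /existsPn dbl0'] := boolP [exists u : G', u + u != 0].
  exact/conj_f/parity_inv/(parity_iso_double dm' dm gK gM u0_neq).
(* Now [f] need not preserve parity, so [gamma] comes from comparing orders and not from [f]. *)
have {}dbl0 (u : G) : u + u = 0 by apply/eqP/negPn/dbl0.
have {}dbl0' (u : G') : u + u = 0 by apply/eqP/negPn/dbl0'.
subst alpha alpha'; have [[m_gt1 m_even _ _] [m'_gt1 m'_even _ _]] := (dm, dm').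
have fD : {morph f : x y / x + y}.
  by move=> x y; rewrite -!dih_mul_trivial.
have gD : {morph g : x y / x + y}.
  by move=> x y; rewrite -!dih_mul_trivial.
have eq_m : m = m'.
  apply/eqP; rewrite eqn_dvd (dih_trivial_dvd m_gt1 m'_gt1 _ dbl0' _ fD) //.
    by rewrite (dih_trivial_dvd m'_gt1 m_gt1 _ dbl0 _ gD) //; apply: can_inj gK.
  exact: can_inj fK.
split=> //; subst m'.
have cardG : #|G| = #|G'|.
  have /eqP := bij_eq_card (Bijective fK gK); rewrite !card_prod.
  by rewrite eqn_pmul2l => [/eqP|]; last by rewrite card_ord.
have [gamma [gammaV [gammaK gammaVK]]] := elementary_iso dbl0 dbl0' cardG.
by exists gamma, gammaV; split=> // u /=; rewrite !perm1 gammaVK.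
Qed.

End DihTheory.

Theorem theorem3p4
  (m : nat) (hm : 2 <= m) (m_even : ~~ odd m)
  (G : finZmodType) (alpha : {perm G}) (alphaA : alpha \in Aut [set: G])
  (alpha2 : 2 < m -> (alpha ^+ 2)%g = 1%g)
  (m' : nat) (hm' : 2 <= m') (m'_even : ~~ odd m')
  (G' : finZmodType) (alpha' : {perm G'}) (alphaA' : alpha' \in Aut [set: G'])
  (alpha2' : 2 < m' -> (alpha' ^+ 2)%g = 1%g) :
  loop_isomorphic (Dih m alpha) (Dih m' alpha') <->
  m = m' /\
  exists (gamma : {additive G -> G'}) (gammaV : G' -> G),
    [/\ cancel gamma gammaV, cancel gammaV gamma &
        gamma \o alpha \o gammaV =1 alpha'].
Proof.
have dm : dih_datum m alpha by split=> //; apply/Aut_zmodP.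
have dm' : dih_datum m' alpha' by split=> //; apply/Aut_zmodP.
split=> [[f [g fK gK] fM] | [eq_m [gamma [gammaV [gammaK gammaVK conj]]]]].
  exact: dih_iso_conj dm dm' fK gK fM.
subst m'; pose f (x : 'Z_m * G) := (x.1, gamma x.2).
exists f.
  by exists (fun x => (x.1, gammaV x.2)) => -[i u]; rewrite /f /= ?gammaK ?gammaVK.
case=> i u [j v].
(* The product involves unreduced powers of [alpha], so every exponent is treated. *)
have conjX n w : gamma ((alpha ^+ n)%g w) = (alpha' ^+ n)%g (gamma w).
  elim: n => [|n IHn]; first by rewrite !expg0 !perm1.
  by rewrite !expgSr !permM -IHn -conj /= gammaK.
by rewrite /f /= conjX GRing.raddfD raddfMz.
Qed.
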